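(* Let $\mathcal{G}$ be a sparsity pattern and let $m$ be the number of $\beta$-nodes in $\mathcal{G}$. If $\mathcal{G}$ is structurally averaged controllable, then there does not exist a nonnegative integer $k$ such that $|U_\alpha(k)|>mk$.
   Context: Let $n,m$ be positive integers and $\Sigma=[0,1]$. Sparsity patterns. A sparsity pattern is a directed graph $\mathcal{G}=(V,\mathcal{E})$ (self-loops allowed) with node set $V=\{\alpha_1,\ldots,\alpha_n,\beta_1,\ldots,\beta_m\}$ such that no $\beta$-node has an incoming edge. $\mathbb{V}(\mathcal{G})$ denotes the vector space of all pairs $(A,B)\in \mathrm{C}^0(\Sigma,\mathbb{R}^{n\times n}\times\mathbb{R}^{n\times m})$ compliant with $\mathcal{G}$, meaning: the $(j,i)$ entry of $A$ is the zero function whenever $(\alpha_i,\alpha_j)\notin\mathcal{E}$, and the $(j,i)$ entry of $B$ is the zero function whenever $(\beta_i,\alpha_j)\notin\mathcal{E}$. Averaged controllability. Given continuous $A:\Sigma\to\mathbb{R}^{n\times n}$ and $B:\Sigma\to\mathbb{R}^{n\times m}$, consider the linear ensemble system $$\frac{\partial}{\partial t}x(t,\sigma)=A(\sigma)x(t,\sigma)+B(\sigma)u(t),\qquad \sigma\in\Sigma,\ t\ge 0, \tag{E}$$ with $x(t,\sigma)\in\mathbb{R}^n$ and a control input $u(t)\in\mathbb{R}^m$ that does not depend on $\sigma$. System (E) is averaged controllable if for any $x_0\in\mathbb{R}^n$ and any initial profile $x(0,\cdot)\in \mathrm{C}^0(\Sigma,\mathbb{R}^n)$ with $\int_0^1 x(0,\sigma)\,\mathrm{d}\sigma=x_0$,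 any target $x^*\in\mathbb{R}^n$, and any time $T>0$, there is $u\in \mathrm{L}^1([0,T];\mathbb{R}^m)$ such that $\int_0^1 x(T,\sigma)\,\mathrm{d}\sigma=x^*$. $\mathcal{G}$ is structurally averaged controllable if there is a pair $(A,B)\in\mathbb{V}(\mathcal{G})$ such that (E) is averaged controllable. For a nonnegative integer $k$, $U_\alpha(k)$ is the set of $\alpha$-nodes $\alpha_i$ such that there does not exist a walk in $\mathcal{G}$ from any $\beta$-node to $\alpha_i$ of length (number of edges, counted with repetition) greater than $k$. Walks are directed and may repeat nodes and edges. *)

(* Defs.v *)
From HB Require Import structures.
From mathcomp Require Import all_boot all_order all_algebra.
From mathcomp Require Import all_classical all_reals all_analysis.

Set Implicit Arguments.
Unset Strict Implicit.
Unset Printing Implicit Defensive.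

Import Order.TTheory GRing.Theory Num.Theory.
Import numFieldNormedType.Exports.

Local Open Scope classical_set_scope.
Local Open Scope ring_scope.

(* [inl i] is the node alpha_i and [inr j] is the node beta_j. *)
Record sparsity_pattern (n m : nat) := SparsityPattern {
  edge :> rel ('I_n + 'I_m);
  no_edge_to_beta : forall (v : 'I_n + 'I_m) (j : 'I_m), ~~ edge v (inr j)
}.

Section Ensemble.
Variables (R : realType) (n m : nat).
Implicit Types (A : R -> 'M[R]_n) (B : R -> 'M[R]_(n, m)).
Implicit Types (G : sparsity_pattern n m) (T : R).

(* An element of C^0([0, 1], E) is given by a function R -> E that is
   continuous within [0, 1]; its values outside [0, 1] are never used. *)
Definition compliant G A B : Prop :=
  [/\ {within `[0, 1], continuous A},
      {within `[0, 1], continuous B},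
      forall i j : 'I_n, ~~ G (inl i) (inl j) ->
        forall s, s \in `[0, 1] -> A s j i = 0
    & forall (i : 'I_m) (j : 'I_n), ~~ G (inr i) (inl j) ->
        forall s, s \in `[0, 1] -> B s j i = 0].

Definition vec_int p (D : set R) (f : R -> 'cV[R]_p) : 'cV[R]_p :=
  \col_i \int[lebesgue_measure]_(s in D) f s i 0.

Definition L1_control T (u : R -> 'cV[R]_m) : Prop :=
  forall i : 'I_m,
    lebesgue_measure.-integrable `[0, T] (EFin \o (fun t => u t i 0)).

(* Since u is only integrable, the differential equation is understood in the
   sense of Caratheodory, i.e., through the integral equation, for each s. *)
Definition ensemble_solution A B T (u : R -> 'cV[R]_m)
    (x : R -> R -> 'cV[R]_n) : Prop :=
  forall s, s \in `[0, 1] ->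
    {within `[0, T], continuous (x ^~ s)} /\
    forall t, t \in `[0, T] ->
      x t s = x 0 s + vec_int `[0, t] (fun r => A s *m x r s + B s *m u r).

(* For given u and initial profile the solution exists, is unique on
   [0, T] x [0, 1], and is continuous in s, so quantifying x existentially
   amounts to speaking of "the" trajectory generated by u. *)
Definition averaged_controllable A B : Prop :=
  forall (x0 : 'cV[R]_n) (xi : R -> 'cV[R]_n),
    {within `[0, 1], continuous xi} -> vec_int `[0, 1] xi = x0 ->
  forall (xT : 'cV[R]_n) T, 0 < T ->
  exists (u : R -> 'cV[R]_m) (x : R -> R -> 'cV[R]_n),
    [/\ L1_control T u,
        ensemble_solution A B T u x,
        forall s, s \in `[0, 1] -> x 0 s = xi s
      & vec_int `[0, 1] (x T) = xT].

Definition structurally_averaged_controllable G : Prop :=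
  exists A B, compliant G A B /\ averaged_controllable A B.

End Ensemble.

(* A walk of length l starting at v is a sequence p of size l, listing the
   nodes visited after v, with [path G v p]; it ends at [last v p]. *)
Definition U_alpha n m (G : sparsity_pattern n m) (k : nat) : {set 'I_n} :=
  [set i | `[< ~ exists (j : 'I_m) (p : seq ('I_n + 'I_m)),
      [/\ path G (inr j) p, last (inr j) p = inl i & (k < size p)%N] >]].

(* Main.v *)
Require Import Defs.
From mathcomp Require Import all_boot all_order all_algebra.
From mathcomp Require Import all_classical all_reals all_analysis.
From mathcomp Require Import ring lra.
Set Implicit Arguments.
Unset Strict Implicit.
Unset Printing Implicit Defensive.
Import Order.TTheory GRing.Theory Num.Theory.
Import numFieldNormedType.Exports.
Local Open Scope classical_set_scope.
Local Open Scope ring_scope.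

(** Let S be [U_alpha G k], and fix a parameter s with matrices A and B
complying with G.  A walk of length l + 1 from beta_j to alpha_i is what a
nonzero entry (i, j) of A^l B requires, so for i in S these entries vanish as
soon as l >= k.  Starting from the zero profile, the variation of constants
formula then has only k terms in its i-th coordinate:

  x_i(t, s) = sum_(l < k) sum_j (A(s)^l B(s))_ij * w_(l+1, j)(t),

where w_(l, j) is the l-fold iterated integral of u_j.  The functions w depend
neither on s nor on i, so averaging over s expresses the coordinates in S of
the averaged state at time T as the image of the k * m numbers w_(l+1, j)(T)
under a matrix that does not depend on u.  If k * m < |S|, some nonzero linear
form on these coordinates kills this image, and a target on which the form is
nonzero cannot be reached.

The expansion ([truncated_expansion]) is proved without matrix exponentials,
by induction on k: every in-neighbour among the alpha-nodes of a node of
U_alpha(k+1) lies in U_alpha(k) ([U_alpha_edge]), so substituting the expansion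
for k into the integral equation gives the one for k + 1.  For k = 0 the
coordinates in U_alpha(0) satisfy a closed homogeneous linear system, and they
vanish because such a system has only the zero solution starting at 0
([unreachable_eq0], by the Gronwall-type estimate [gronwall_eq0]).  The linear
form is given by [left_kernel_combination]. *)

(** * Integrals and continuity *)

Lemma integrable_lincomb d (T : measurableType d) (R : realType)
    (mu : {measure set T -> \bar R}) (D : set T) (I : Type) (r : seq I)
    (c : I -> R) (f : I -> T -> R) : measurable D ->
  (forall i, mu.-integrable D (EFin \o f i)) ->
  mu.-integrable D (EFin \o (fun t => \sum_(i <- r) c i * f i t)).
Proof.
move=> mD intf.
have -> : EFin \o (fun t => \sum_(i <- r) c i * f i t) =
    (fun t => (\sum_(i <- r) (c i)%:E * (f i t)%:E)%E).
  by apply/funext => t /=; rewrite sumEFin.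
apply: integrable_sum => // i _.
exact: (integrableZl mD (c i) (intf i)).
Qed.

Lemma Rintegral_lincomb d (T : measurableType d) (R : realType)
    (mu : {measure set T -> \bar R}) (D : set T) (I : Type) (r : seq I)
    (c : I -> R) (f : I -> T -> R) : measurable D ->
  (forall i, mu.-integrable D (EFin \o f i)) ->
  \int[mu]_(t in D) (\sum_(i <- r) c i * f i t) =
  \sum_(i <- r) c i * \int[mu]_(t in D) f i t.
Proof.
move=> mD intf; elim: r => [|i s IH].
  rewrite big_nil (@eq_Rintegral _ _ _ mu D (cst 0)) ?Rintegral_cst ?mul0r//.
  by move=> t _; rewrite big_nil.
rewrite big_cons -IH -RintegralZl// -RintegralD//.
- by apply: eq_Rintegral => t _; rewrite big_cons.
- exact: (integrableZl mD (c i) (intf i)).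
- exact: integrable_lincomb.
Qed.

Section real_functions.
Context {R : realType}.
Notation mu := (@lebesgue_measure R).

Lemma continuous_itv_integrable (f : R -> R) (a b : R) :
  {within `[a, b], continuous f} -> mu.-integrable `[a, b] (EFin \o f).
Proof. by apply: continuous_compact_integrable; exact: segment_compact. Qed.

Lemma within_continuous_sum (D : set R) (I : Type) (r : seq I)
    (f : I -> R -> R) : (forall i, {within D, continuous f i}) ->
  {within D, continuous (fun t => \sum_(i <- r) f i t)}.
Proof.
move=> cf; elim: r => [|i r IH].
  by under eq_fun do rewrite big_nil; move=> x; exact: cvg_cst.
by under eq_fun do rewrite big_cons; exact: within_continuousD.
Qed.

Lemma within_continuous_coord (D : set R) p q (A : R -> 'M[R]_(p, q)) i j :
  {within D, continuous A} -> {within D, continuous (fun s => A s i j)}.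
Proof.
apply: (@within_continuous_comp _ _ _ _ A (fun M : 'M[R]_(p, q) => M i j)).
by move=> M _; exact: coord_continuous.
Qed.

Lemma continuous_expRM (L : R) : continuous (fun t : R => expR (L * t)).
Proof.
by move=> t; apply: differentiable_continuous; apply/derivable1_diffP.
Qed.

Lemma Rintegral_expRM (L c : R) : L != 0 -> 0 < c ->
  \int[mu]_(t in `[0, c]) (L * expR (L * t)) = expR (L * c) - 1.
Proof.
move=> L0 c0.
have dF (t : R) : is_derive t 1 (fun t : R => expR (L * t)) (L * expR (L * t)).
  by apply: is_derive_eq; rewrite scaler1 mulrC.
have cF := @continuous_expRM L.
rewrite /Rintegral (@continuous_FTC2 _ _ (fun t : R => expR (L * t))) //=.
- by rewrite mulr0 expR0.
- apply: continuous_subspaceT => t; apply: cvgM; [exact: cvg_cst|exact: cF].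
- split.
  + by move=> t _; apply: ex_derive.
  + by apply: cvg_at_right_filter; exact: cF.
  + by apply: cvg_at_left_filter; exact: cF.
- by move=> t _; rewrite derive1E; exact: derive_val.
Qed.

(** With h(t) = exp(- K t) g(t) maximal at c, the estimate at c reads
exp(K c) h(c) <= L * int_0^c exp(K t) h(c) dt <= (L / K) exp(K c) h(c),
which forces h(c) <= 0 as soon as K > L. *)
Lemma gronwall_eq0 (g : R -> R) (L T : R) : 0 <= L ->
  {within `[0, T], continuous g} -> {in `[0, T], forall t, 0 <= g t} ->
  {in `[0, T], forall t, g t <= L * \int[mu]_(r in `[0, t]) g r} ->
  {in `[0, T], forall t, g t = 0}.
Proof.
move=> L0 cg g0 gL t tT.
have T0 : 0 <= T by move: tT; rewrite in_itv/= => /andP[]; exact: le_trans.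
(* K = 2 (L + 1) is positive even if L = 0, and makes L / K at most 1 / 2. *)
pose K : R := 2 * (L + 1).
have K0 : 0 < K by rewrite mulr_gt0// ltr_wpDl.
pose h r := expR (- K * r) * g r.
have ch : {within `[0, T], continuous h}.
  move=> x; apply: cvgM; last exact: cg.
  apply: (continuous_subspaceT (A := `[0, T]%classic)
    (f := fun r => expR (- K * r))).
  exact: continuous_expRM.
have [c cT hc] := EVT_max T0 ch.
have ghE r : g r = expR (K * r) * h r.
  by rewrite /h mulrA -expRD mulNr subrr expR0 mul1r.
have /andP[c0 cleT] : 0 <= c <= T by move: cT; rewrite in_itv.
suff hc0 : h c <= 0.
  apply/eqP; rewrite eq_le g0// andbT ghE.
  by rewrite pmulr_rle0 ?expR_gt0// (le_trans (hc _ tT)).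
have [c00|c_gt0] := eqVneq c 0.
  have := gL _ cT; rewrite c00 set_itv1 Rintegral_set1 mulr0 => g00.
  by rewrite /h pmulr_rle0 ?expR_gt0// c00.
have {}c_gt0 : 0 < c by rewrite lt_def c_gt0.
have sub0c r : r \in `[0, c] -> r \in `[0, T].
  by rewrite !in_itv/= => /andP[-> /le_trans ->].
have igc : mu.-integrable `[0, c] (EFin \o g).
  apply: continuous_itv_integrable; apply: continuous_subspaceW cg => r.
  exact: sub0c.
have iec :
    mu.-integrable `[0, c] (EFin \o (fun r => h c / K * (K * expR (K * r)))).
  apply: continuous_itv_integrable; apply: continuous_subspaceT => r.
  do 2 (apply: cvgM; first exact: cvg_cst).
  exact: continuous_expRM.
have hc_ge0 : 0 <= h c by rewrite mulr_ge0 ?expR_ge0// g0.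
have : \int[mu]_(r in `[0, c]) g r <= h c / K * (expR (K * c) - 1).
  rewrite -(Rintegral_expRM (lt0r_neq0 K0) c_gt0) -RintegralZl//; last first.
    apply: continuous_itv_integrable; apply: continuous_subspaceT => r.
    apply: cvgM; first exact: cvg_cst.
    exact: continuous_expRM.
  apply: le_Rintegral => // r rc.
  rewrite mulrA divfK ?lt0r_neq0// ghE mulrC ler_wpM2r ?expR_ge0//.
  exact/hc/sub0c.
move=> /(ler_wpM2l L0)/(le_trans (gL _ cT)).
rewrite ghE => H.
have e0 := expR_gt0 (K * c).
suff : expR (K * c) * h c <= expR (K * c) * h c / 2.
  by move=> ?; rewrite -(pmulr_rle0 _ e0); lra.
apply: (le_trans H).
have -> : expR (K * c) * h c / 2 = (L + 1) * (h c / K * expR (K * c)).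
  rewrite /K; field; rewrite ?lt0r_neq0//; exact: ltr_wpDl.
apply: ler_pM => //.
- apply: mulr_ge0; first by rewrite divr_ge0// ltW.
  by rewrite subr_ge0 -expR0 ler_expR mulr_ge0// ltW.
- by rewrite lerDl.
- rewrite ler_wpM2l ?divr_ge0 ?(ltW K0)//.
  by rewrite gerDl.
Qed.

End real_functions.

(** * Linear dependence among more vectors than coordinates *)

Lemma left_kernel_combination (F : fieldType) (I J : finType) (S : {set I})
    (M : I -> J -> F) : (#|J| < #|S|)%N ->
  exists2 c : I -> F, (exists2 i, i \in S & c i != 0) &
    forall j, \sum_(i in S) c i * M i j = 0.
Proof.
move=> JS.
pose N : 'M[F]_(#|S|, #|J|) := \matrix_(p, q) M (enum_val p) (enum_val q).
have : kermx N != 0.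
  rewrite kermx_eq0 /row_free neq_ltn (leq_ltn_trans (rank_leq_col N))//.
case/matrix0Pn => p0 [p1 cp].
have S0 : enum_val p1 \in S by exact: enum_valP.
exists (fun i => kermx N p0 (enum_rank_in S0 i)).
  by exists (enum_val p1) => //; rewrite enum_valK_in.
move=> j.
have := congr1 (fun A : 'M[F]_(_, _) => A p0 (enum_rank j)) (mulmx_ker N).
rewrite mxE [RHS]mxE => H; apply: etrans H; rewrite big_enum_val.
by apply: eq_bigr => p _; rewrite [N _ _]mxE enum_rankK enum_valK_in.
Qed.

(** * The sets of nodes reached by short walks only *)

Lemma U_alphaP n m (G : sparsity_pattern n m) k i :
  reflect (forall j p, path G (inr j) p -> last (inr j) p = inl i ->
             (size p <= k)%N)
          (i \in U_alpha G k).
Proof.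
rewrite inE; apply: (iffP (asboolP _)) => [Ui j p Gp lp|Ui [j [p [Gp lp]]]].
  by rewrite leqNgt; apply/negP => kp; apply: Ui; exists j, p.
by rewrite ltnNge (Ui j).
Qed.

(** A walk to j extends by the edge to a walk to i that is one longer.  The
predecessor also covers k = 0: a node reached by no walk of positive length has
no in-neighbour reached by such a walk. *)
Lemma U_alpha_edge n m (G : sparsity_pattern n m) k i j :
  i \in U_alpha G k -> G (inl j) (inl i) -> j \in U_alpha G k.-1.
Proof.
move=> /U_alphaP Ui ji; apply/U_alphaP => b p Gp lp.
have := Ui b (rcons p (inl i)); rewrite rcons_path last_rcons size_rcons Gp lp.
by move=> /(_ ji erefl) /=; case: k {Ui}.
Qed.

Lemma U_alpha0_input n m (G : sparsity_pattern n m) i j :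
  i \in U_alpha G 0 -> ~~ G (inr j) (inl i).
Proof.
move=> /U_alphaP Ui; apply/negP => ji.
by have := Ui j [:: inl i]; rewrite /= ji => /(_ erefl erefl).
Qed.

(** * Trajectories for a fixed parameter *)

Section trajectory.
Context {R : realType}.
Notation mu := (@lebesgue_measure R).

(** For l > 0, Cauchy's formula gives the value at t as the integral over [0, t]
of f(r) (t - r)^(l-1) / (l-1)!, that is, f convolved with the factor of the
power l - 1 in the exponential series.  The recursive form is the one that
matches substitution into an integral equation. *)
Fixpoint iterated_integral (f : R -> R) (l : nat) : R -> R :=
  if l is l'.+1 then fun t => \int[mu]_(r in `[0, t]) iterated_integral f l' r
  else f.

Lemma iterated_integral_integrable (f : R -> R) (T : R) (l : nat) : 0 <= T ->
  mu.-integrable `[0, T] (EFin \o f) ->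
  mu.-integrable `[0, T] (EFin \o iterated_integral f l).
Proof.
move=> T0 intf; elim: l => //= l IH.
apply: continuous_itv_integrable.
exact: (@parameterized_integral_continuous R 0 T (iterated_integral f l)).
Qed.

Lemma integrable_sub_itv0 (f : R -> R) (T t : R) : t \in `[0, T] ->
  mu.-integrable `[0, T] (EFin \o f) -> mu.-integrable `[0, t] (EFin \o f).
Proof.
rewrite in_itv/= => /andP[_ tT]; apply: integrableS => // r /=.
by rewrite !in_itv/= => /andP[-> /le_trans ->].
Qed.

Variables (n m : nat) (G : sparsity_pattern n m).
Variables (a : 'M[R]_n) (b : 'M[R]_(n, m)) (T : R).
Hypothesis aG : forall i j, ~~ G (inl i) (inl j) -> a j i = 0.
Hypothesis bG : forall i j, ~~ G (inr i) (inl j) -> b j i = 0.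
Hypothesis T0 : 0 <= T.
Variables (u : R -> 'cV[R]_m) (x : R -> 'cV[R]_n).
Hypothesis uL1 : L1_control T u.
Hypothesis cx : {within `[0, T], continuous x}.
Hypothesis x0 : x 0 = 0.
Hypothesis xE : forall t, t \in `[0, T] ->
  x t = x 0 + vec_int `[0, t] (fun r => a *m x r + b *m u r).

Let cxi i : {within `[0, T], continuous (fun t => x t i 0)}.
Proof. exact: within_continuous_coord cx. Qed.

Let int_xi i t : t \in `[0, T] ->
  mu.-integrable `[0, t] (EFin \o (fun r => x r i 0)).
Proof.
by move=> tT; apply: (integrable_sub_itv0 tT); exact: continuous_itv_integrable.
Qed.

Lemma trajectory_coordE i t : t \in `[0, T] ->
  x t i 0 = \sum_j a i j * \int[mu]_(r in `[0, t]) x r j 0 +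
            \sum_j b i j * \int[mu]_(r in `[0, t]) u r j 0.
Proof.
move=> tT; rewrite {1}xE// x0 add0r mxE.
have intx j := int_xi j tT.
have intu j := integrable_sub_itv0 tT (uL1 j).
rewrite -!Rintegral_lincomb// -RintegralD//.
- by apply: eq_Rintegral => r _; rewrite !mxE.
- exact: integrable_lincomb.
- exact: integrable_lincomb.
Qed.

(** The solution is an arbitrary one of the integral equation, so this rests on
uniqueness for the homogeneous system restricted to U_alpha(0), in which no
input occurs and which no outside coordinate enters. *)
Lemma unreachable_eq0 i t : i \in U_alpha G 0 -> t \in `[0, T] -> x t i 0 = 0.
Proof.
move=> iU tT; set U := U_alpha G 0.
(* For i in U, only the coordinates in U enter the equation of x_i, each of them
   bounded by g; summing over i gives g(t) <= L * int_0^t g. *)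
pose g r := \sum_(j in U) `|x r j 0|.
pose L := \sum_(i in U) \sum_j `|a i j|.
suff g0 : g t = 0.
  apply/normr0_eq0/eqP; rewrite eq_le normr_ge0 andbT -g0 /g (bigD1 i)//=.
  by rewrite lerDl sumr_ge0.
have cg : {within `[0, T], continuous g}.
  rewrite (_ : g = fun r => \sum_(j <- enum U) `|x r j 0|).
    by apply: within_continuous_sum => j r; apply: cvg_norm; exact: cxi.
  by apply/funext => r; rewrite big_enum.
apply: (@gronwall_eq0 _ g L T _ cg) => //.
- by rewrite sumr_ge0// => j _; rewrite sumr_ge0.
- by move=> r _; rewrite sumr_ge0.
move=> r rT; rewrite {1}/g /L mulr_suml; apply: ler_sum => j jU.
have intg : mu.-integrable `[0, r] (EFin \o g).
  by apply: (integrable_sub_itv0 rT); exact: continuous_itv_integrable.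
rewrite trajectory_coordE// [X in _ + X]big1 ?addr0; last first.
  by move=> l _; rewrite bG ?mul0r// U_alpha0_input.
apply: (le_trans (ler_norm_sum _ _ _));
rewrite mulr_suml; apply: ler_sum => l _.
rewrite normrM; have [Ga|/aG ->] := boolP (G (inl l) (inl j)); last first.
  by rewrite normr0 !mul0r.
have lU : l \in U by exact: (U_alpha_edge jU Ga).
rewrite ler_wpM2l//; apply: (le_trans (le_normr_Rintegral _ _)) => //.
  exact: int_xi.
apply: le_Rintegral => //.
- by have := integrable_norm (int_xi l rT).
- by move=> v _; rewrite /g (bigD1 l)//= lerDl sumr_ge0.
Qed.

(** Substituting the integral equation into itself follows the edges of G
backwards.  Each substitution lowers the index of the set U_alpha by one, down
to U_alpha(0), where the coordinates are zero, so the sum stops at k. *)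
Lemma truncated_expansion k i t : i \in U_alpha G k -> t \in `[0, T] ->
  x t i 0 = \sum_(l < k) \sum_j iter l (mulmx a) b i j *
              iterated_integral (fun r => u r j 0) l.+1 t.
Proof.
elim: k i t => [|k IH] i t iU tT; first by rewrite big_ord0 unreachable_eq0.
rewrite trajectory_coordE// big_ord_recl addrC; congr (_ + _).
(* Both sides are brought to the expansion for k, integrated once and
   multiplied by the i-th row of a; its l-th term becomes the term l + 1. *)
transitivity (\sum_q a i q * \sum_(l < k) \sum_j iter l (mulmx a) b q j *
   iterated_integral (fun r => u r j 0) l.+2 t); last first.
  under eq_bigr do rewrite mulr_sumr; rewrite exchange_big/=.
  apply: eq_bigr => l _.
  under eq_bigr do rewrite mulr_sumr; rewrite exchange_big/=.
  apply: eq_bigr => j _; rewrite mxE mulr_suml.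
  by apply: eq_bigr => q _; rewrite mulrA.
apply: eq_bigr => q _.
have [Ga|/aG ->] := boolP (G (inl q) (inl i)); last by rewrite !mul0r.
congr (_ * _); have qU := U_alpha_edge iU Ga.
have intw l j : mu.-integrable `[0, t]
    (EFin \o iterated_integral (fun r => u r j 0) l).
  apply: (integrable_sub_itv0 tT); exact: iterated_integral_integrable.
(* The factors 1 give the outer sum the shape of a linear combination. *)
transitivity (\int[mu]_(r in `[0, t]) (\sum_(l < k) 1 * \sum_j
    iter l (mulmx a) b q j * iterated_integral (fun r => u r j 0) l.+1 r)).
  apply: eq_Rintegral => r; rewrite inE/= in_itv/= => /andP[r0 rt].
  rewrite (IH q)//; first by apply: eq_bigr => l _; rewrite mul1r.
  by move: tT; rewrite !in_itv/= r0 => /andP[_]; exact: le_trans.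
rewrite Rintegral_lincomb//; last by move=> l; exact: integrable_lincomb.
by apply: eq_bigr => l _; rewrite mul1r Rintegral_lincomb.
Qed.

End trajectory.

(** * Averaging over the parameter *)

Lemma within_continuous_iter_mulmx (R : realType) (D : set R) n m
    (A : R -> 'M[R]_n) (B : R -> 'M[R]_(n, m)) l i j :
  {within D, continuous A} -> {within D, continuous B} ->
  {within D, continuous (fun s => iter l (mulmx (A s)) (B s) i j)}.
Proof.
move=> cA cB; elim: l i j => [|l IH] i j /=.
  exact: within_continuous_coord.
under eq_fun do rewrite mxE.
apply: within_continuous_sum => q s; apply: cvgM; last exact: IH.
exact: (@within_continuous_coord _ _ _ _ A i q cA).
Qed.

(** Only the matrix entries depend on s, so averaging replaces them by their
integrals and leaves the k * m input-dependent factors untouched. *)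
Lemma averaged_expansion (R : realType) n m (G : sparsity_pattern n m)
    (A : R -> 'M[R]_n) (B : R -> 'M[R]_(n, m)) (T : R) (u : R -> 'cV[R]_m)
    (x : R -> R -> 'cV[R]_n) k i :
  compliant G A B -> 0 <= T -> L1_control T u -> ensemble_solution A B T u x ->
  (forall s, s \in `[0, 1] -> x 0 s = 0) -> i \in U_alpha G k ->
  vec_int `[0, 1] (x T) i 0 =
  \sum_(lj : 'I_k * 'I_m)
    (\int[lebesgue_measure]_(s in `[0, 1])
       iter lj.1 (mulmx (A s)) (B s) i lj.2) *
    iterated_integral (fun r => u r lj.2 0) lj.1.+1 T.
Proof.
move=> [cA cB AG BG] T0 uL1 xE x0 iU; rewrite mxE.
under [RHS]eq_bigr do rewrite mulrC.
rewrite -Rintegral_lincomb//; last first.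
  move=> lj; apply: continuous_itv_integrable.
  exact: within_continuous_iter_mulmx.
apply: eq_Rintegral => s; rewrite inE => s01.
have [cx xsE] := xE s s01.
rewrite (@truncated_expansion R n m G (A s) (B s) T _ _ _ u (x ^~ s)
  _ _ _ _ k)//.
- by rewrite pair_bigA; apply: eq_bigr => lj _; rewrite mulrC.
- by move=> *; exact: AG.
- by move=> *; exact: BG.
- exact: x0.
- by rewrite in_itv/= T0 lexx.
Qed.

Theorem proposition2p4 (R : realType) (n m : nat) (hn : (0 < n)%N)
    (hm : (0 < m)%N) (G : sparsity_pattern n m) :
  structurally_averaged_controllable R G ->
  ~ exists k : nat, (m * k < #|U_alpha G k|)%N.
Proof.
move=> [A [B [GAB AC]]] [k mkU].
pose M i (lj : 'I_k * 'I_m) :=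
  \int[lebesgue_measure]_(s in `[0, 1]) iter lj.1 (mulmx (A s)) (B s) i lj.2.
have [|c [i0 i0U ci0] cM] := @left_kernel_combination _ _ _ (U_alpha G k) M.
  by rewrite card_prod !card_ord mulnC.
(* A target on which the linear form c takes the value c i0. *)
pose xT : 'cV[R]_n := delta_mx i0 0.
have [|u [x [uL1 xE x0 xTE]]] :=
    AC (vec_int `[0, 1] (cst 0)) (cst 0) _ erefl xT 1 ltr01.
  by move=> s; exact: cvg_cst.
have : \sum_(i in U_alpha G k) c i * xT i 0 = 0.
  rewrite -xTE.
  under eq_bigr => i iU do
    rewrite (averaged_expansion GAB ler01 uL1 xE x0 iU) mulr_sumr.
  rewrite exchange_big/= big1// => lj _.
  under eq_bigr do rewrite mulrA.
  by rewrite -mulr_suml (cM lj) mul0r.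
rewrite (bigD1 i0)//= big1 => [|i /andP[_ /negPf ii0]]; last first.
  by rewrite mxE ii0 mulr0.
by rewrite mxE !eqxx mulr1 addr0; apply/eqP.
Qed.
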